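(* Let $X$ be a Baire space, $Y$ a topological space, $(Z,d)$ a metric space, and $f:X\times Y\to Z$ a mapping. Suppose that for each point $y$ in a dense subset of $Y$, Player I has a winning strategy in the game $G(\mathcal A(Y),y)$ on $Y$. If $f_x$ is continuous for every $x\in X$ and $f^y$ is quasicontinuous for every $y\in Y$, then $f$ is quasicontinuous.
   Context: No separation axioms are assumed on topological spaces. Sections: for $f:X\times Y\to Z$, put $f_x:Y\to Z$, $f_x(y)=f(x,y)$, and $f^y:X\to Z$, $f^y(x)=f(x,y)$. A mapping $g:T\to Z$ from a topological space $T$ to a metric space $(Z,d)$ is quasicontinuous if for every $\varepsilon>0$, every $t\in T$ and every neighborhood $V$ of $t$ in $T$ there is a nonempty open set $O\subset V$ with $d(g(t),g(s))<\varepsilon$ for each $s\in O$. $\mathcal A(Y)$ is the collection of all somewhere dense subsets of $Y$, i.e. those $F\subset Y$ with $\mathrm{Int}(\overline F)\neq\emptyset$. Game $G(\mathcal L,y)$ on $Y$ (for a collection $\mathcal L$ of nonempty subsets of $Y$ and $y\in Y$): at each stage $n=0,1,2,\dots$ Player I chooses $L_n\in\mathcal L$ and then Player II chooses a point $y_n\in L_n$. Player I wins the play if $y\in\overline{\{y_n:n\in\mathbb N\}}$; otherwise Player II wins. A strategy for Player I is a map $\tau$ assigning to each finite sequence in $Y$ (including the empty one) a member of $\mathcal L$; it is winning if $y\in\overline{\{y_n:n\in\mathbb N\}}$ for every sequence $(y_n)$ with $y_0\in\tau(\emptyset)$ and $y_{n+1}\in\tau(y_0,\dots,y_n)$ for all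 $n$. *)

(* Defs.v *)
From mathcomp Require Import all_boot all_order all_algebra.
From mathcomp Require Import all_classical all_reals all_analysis.

Set Implicit Arguments.
Unset Strict Implicit.
Unset Printing Implicit Defensive.

Import Order.TTheory GRing.Theory Num.Theory.

Local Open Scope classical_set_scope.
Local Open Scope ring_scope.

Definition baire_space (X : topologicalType) : Prop :=
  forall U : nat -> set X,
    (forall n, open (U n) /\ dense (U n)) -> dense (\bigcap_n U n).

Definition quasicontinuous (R : realType) (T : topologicalType)
    (Z : metricType R) (g : T -> Z) : Prop :=
  forall (eps : R) (t : T) (V : set T), 0 < eps -> nbhs t V ->
    exists O : set T, [/\ open O, O !=set0, O `<=` V &
      forall s, O s -> mdist (g t) (g s) < eps].

Definition somewhere_dense (Y : topologicalType) : set_system Y :=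
  [set F : set Y | interior (closure F) !=set0].

(* The collection is legal for the game: its members are nonempty, so
   Player II always has a move. *)
Lemma somewhere_dense_neq0 (Y : topologicalType) (F : set Y) :
  somewhere_dense F -> F !=set0.
Proof. by case=> y /interior_subset /(_ _ filterT) [z [Fz _]]; exists z. Qed.

Definition is_strategy_I (Y : topologicalType) (L : set_system Y)
    (tau : seq Y -> set Y) : Prop :=
  forall s, L (tau s).

(* [mkseq y_ n] is the sequence y_0, ..., y_(n-1) of Player II's earlier moves
   (empty when n = 0). *)
Definition winning_for_I (Y : topologicalType) (y : Y)
    (tau : seq Y -> set Y) : Prop :=
  forall y_ : nat -> Y, (forall n, tau (mkseq y_ n) (y_ n)) ->
    closure (range y_) y.

Definition I_has_winning_strategy (Y : topologicalType) (L : set_system Y)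
    (y : Y) : Prop :=
  exists tau : seq Y -> set Y, is_strategy_I L tau /\ winning_for_I y tau.

(* Main.v *)
Require Import Defs.
From mathcomp Require Import all_boot all_order all_algebra.
From mathcomp Require Import all_classical all_reals all_analysis.
From mathcomp Require Import lra.

Import Order.TTheory GRing.Theory Num.Theory.

Local Open Scope classical_set_scope.
Local Open Scope ring_scope.

(** Suppose that quasicontinuity fails at a point (x0, y0), for eps and a
    neighbourhood U x V, and put a = f (x0, y0).  After shrinking U and V, there
    is a point y1 of V at which Player I has a winning strategy tau, with
    f (x, y1) within eps / 3 of a for every x in U (continuity of f (x0, _), then
    quasicontinuity of f (_, y1)).  On the other hand, every nonempty open box
    inside U x V contains a point whose value is at distance at least eps from a.

    Player II uses these far values against tau.  Facing a somewhere dense set F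
    and a nonempty open G inside U, Player II finds y in F and a nonempty open H
    inside G such that either y is outside V, or f (x, y) stays at distance at
    least 2 eps / 3 from a for all x in H ([far_reply]).  The reply y is thus
    tied to an open set of x, and a single play has to be good for a single x.
    The Baire property supplies that x: among the nested choices of H, there is
    a point x and a play of tau all of whose moves are good at that x
    ([baire_play], which is the theorem that in a Baire space the player who
    wants an empty intersection has no winning strategy in the Banach-Mazur
    game).

    Since tau is winning, y1 is in the closure of the points played, so
    continuity of f (x, _) at y1 gives a move y in V with f (x, y) within
    2 eps / 3 of a, which contradicts the choice of the moves. *)

(** Such a family is the same as a locally constant partial map from X to S with
    an open domain that is dense in U, A s being the fibre over s.  Disjointness is what makes
    the value at a point x well defined, hence what lets successive choices be
    read off from x. *)
Definition open_almost_partition {X : topologicalType} {S : Type} (U : set X)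
    (A : S -> set X) :=
  [/\ forall s, open (A s),
      forall s t x, A s x -> A t x -> s = t &
      forall G, open G -> G !=set0 -> G `<=` U -> exists s, A s `&` G !=set0].

(** A maximal disjoint family of open sets labelled as required has union
    dense in U: any nonempty open subset of U that it misses could be shrunk and added to it. *)
Lemma open_almost_partition_exists {X : topologicalType} {S : Type} (U : set X)
    (Q : S -> set X) :
  (forall G, open G -> G !=set0 -> G `<=` U ->
     exists s H, [/\ open H, H !=set0, H `<=` G & H `<=` Q s]) ->
  exists A : S -> set X,
    open_almost_partition U A /\ forall s, A s `<=` Q s.
Proof.
move=> hQ.
pose ok (B : set (S * X)) := [/\ forall s, open [set x | B (s, x)],
  forall s t x, B (s, x) -> B (t, x) -> s = t &
  forall s x, B (s, x) -> Q s x].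
have [B [[Bo Bf BQ] Bmax]] : exists B, ok B /\ forall C, B `<` C -> ~ ok C.
  apply: Zorn_bigcup => F Fok Ftot; split.
  - move=> s.
    have -> : [set x | (\bigcup_(C in F) C) (s, x)]
      = \bigcup_(C in F) [set x | C (s, x)] by [].
    by apply: bigcup_open => C /Fok[].
  - move=> s t x [C FC Cs] [D FD Dt].
    have [CD|DC] := Ftot _ _ FC FD.
    + by have [_ h _] := Fok _ FD; apply: h (CD _ Cs) Dt.
    + by have [_ h _] := Fok _ FC; apply: h Cs (DC _ Dt).
  - by move=> s x [C /Fok[_ _ h] /h].
exists (fun s => [set x | B (s, x)]); split=> //; split=> // G oG G0 GU.
apply: contrapT => noG.
have [s [H [oH [z Hz] HG HQ]]] := hQ G oG G0 GU.
have disj t x : B (t, x) -> ~ H x.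
  by move=> Btx Hx; apply: noG; exists t, x; split=> //; exact: HG.
apply: (Bmax (B `|` [set p | p.1 = s /\ H p.2])).
  split=> [p Bp|/(_ (s, z))]; first by left.
  by move=> /(_ (or_intror (conj erefl Hz)))/disj.
split.
- move=> t.
  have [->|ts] := pselect (t = s).
    have -> : [set x | (B `|` [set p | p.1 = s /\ H p.2]) (s, x)]
      = [set x | B (s, x)] `|` H.
      by apply/seteqP; split=> x /= [?|Hx]; by [left|right; case: Hx|right].
    exact: openU.
  have -> : [set x | (B `|` [set p | p.1 = s /\ H p.2]) (t, x)]
    = [set x | B (t, x)].
    by apply/seteqP; split=> x /=; [case=> [//|[]]|left].
  exact: Bo.
- move=> t u x [Bt|/= [-> Hx]] [Bu|/= [-> Hx']] //.
  + exact: Bf Bt Bu.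
  + by case: (disj _ _ Bt).
  + by case: (disj _ _ Bu).
- by move=> t x [/BQ//|/= [-> /HQ]].
Qed.

(** The move y may depend on an open set of points x, while the conclusion asks
    for one point x and one sequence of moves.  Level n is an almost partition
    of U labelled by the positions of length n, and each level refines the
    previous one; a point of U common to the unions of all levels carries exactly
    one label per level, and these labels are the initial segments of a play. *)
Lemma baire_play {X : topologicalType} {S : Type} (U : set X)
    (P : seq S -> S -> set X) :
  baire_space X -> open U -> U !=set0 ->
  (forall s G, open G -> G !=set0 -> G `<=` U ->
     exists y H, [/\ open H, H !=set0, H `<=` G & H `<=` P s y]) ->
  exists x (y_ : nat -> S), U x /\ forall n, P (mkseq y_ n) (y_ n) x.
Proof.
move=> hX oU U0 hP.
pose good (A : seq S -> set X) := open_almost_partition U A.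
pose refines (A B : seq S -> set X) := forall t x, B t x ->
  exists s y, [/\ t = rcons s y, A s x & P s y x].
have refinable A : exists B, good A -> good B /\ refines A B.
  have [[Ao Af Ad]|nA] := pselect (good A); last by exists A => /nA.
  pose Q t := [set x | exists s y, [/\ t = rcons s y, A s x & P s y x]].
  have [|B [gB BQ]] := @open_almost_partition_exists X (seq S) U Q.
    move=> G oG G0 GU; have [s sG] := Ad G oG G0 GU.
    have [||y [H [oH H0 HG HP]]] := hP s (A s `&` G) _ sG.
    - exact: openI.
    - by move=> x [_ /GU].
    exists (rcons s y), H; split=> // [x /HG[]//|x Hx].
    by exists s, y; split=> //; [case: (HG x Hx)|exact: HP].
  by exists B => _; split.
have [next nextP] := choice refinable.
pose A0 (s : seq S) := [set x | s = [::] /\ U x].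
pose A n := iter n next A0.
have gA n : good (A n).
  elim: n => [|n IH]; last by have [] := nextP _ IH.
  split=> [s|s t x [-> _] [-> _]//|G oG [x Gx] GU].
    have [->|s0] := pselect (s = [::]).
      have -> : A 0%N [::] = U by apply/seteqP; split=> [x []|x].
      exact: oU.
    have -> : A 0%N s = set0 by apply/seteqP; split=> x // [].
    exact: open0.
  by exists [::], x; split=> //; split=> //; exact: GU.
(* The Baire property concerns dense subsets of all of X, so each level is
   completed by the exterior of U. *)
pose W n := (\bigcup_s A n s) `|` ~` closure U.
have /hX Wd : forall n, open (W n) /\ dense (W n).
  move=> n; have [Ao _ Ad] := gA n; split.
    apply: openU; first by apply: bigcup_open => s _; exact: Ao.
    by rewrite openC; exact: closed_closure.
  move=> O [z Oz] oO.
  have [zU|zU] := pselect (closure U z); last by exists z; split=> //; right.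
  have [w [Uw Ow]] := zU O (open_nbhs_nbhs (conj oO Oz)).
  have [|||s [v [Av [Ov _]]]] := Ad (O `&` U).
  - exact: openI.
  - by exists w.
  - by move=> ? [].
  by exists v; split=> //; left; exists s.
have [x [Ux Wx]] := Wd U U0 oU.
have lab n : exists s, A n s x.
  have [[s _ As]|] := Wx n I; first by exists s.
  by case; exact: subset_closure.
have [s_ sP] := choice lab.
have stepx n : exists y, s_ n.+1 = rcons (s_ n) y /\ P (s_ n) y x.
  have [_ ref] := nextP _ (gA n).
  have [s [y [eq As Py]]] := ref _ _ (sP n.+1).
  have [_ Af _] := gA n.
  by exists y; rewrite (Af _ _ _ (sP n) As).
have [y_ yP] := choice stepx.
have sE n : s_ n = mkseq y_ n.
  elim: n => [|n IH]; first by case: (sP 0%N).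
  by rewrite mkseqS -IH; case: (yP n).
by exists x, y_; split=> // n; rewrite -sE; case: (yP n).
Qed.

(** If the interior of the closure of F misses V, any point of F inside it is a
    reply outside V.  Otherwise it meets V in an open set over which a far value
    of f exists; continuity in y moves that value to a point of F and
    quasicontinuity in x spreads it over an open set, at a cost of less than
    eps / 6 each. *)
Lemma far_reply {R : realType} {X Y : topologicalType} {Z : metricType R}
    (f : X * Y -> Z) (eps : R) (a : Z) (U : set X) (V : set Y) :
  (forall x : X, continuous (fun y : Y => f (x, y))) ->
  (forall y : Y, quasicontinuous (fun x : X => f (x, y))) ->
  0 < eps -> open V ->
  (forall G W, open G -> G !=set0 -> G `<=` U ->
     open W -> W !=set0 -> W `<=` V ->
     exists x y, [/\ G x, W y & eps <= mdist a (f (x, y))]) ->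
  forall F G, somewhere_dense F -> open G -> G !=set0 -> G `<=` U ->
  exists y H, [/\ open H, H !=set0, H `<=` G &
    F y /\ forall x, H x -> V y -> 2 / 3 * eps <= mdist a (f (x, y))].
Proof.
move=> hfx hfy e0 oV far F G sF oG G0 GU.
have oI : open (interior (closure F)) by exact: open_interior.
have [IV|IV] := pselect ((interior (closure F) `&` V) !=set0); last first.
  have [z Iz] := sF.
  have [y [Fy Iy]] := interior_subset Iz _ (open_nbhs_nbhs (conj oI Iz)).
  exists y, G; split=> //; split=> // x _ Vy.
  by case: IV; exists y.
have [|x [y [Gx [Iy Vy] fary]]] := far G _ oG G0 GU (openI oI oV) IV.
  by move=> ? [].
have e6 : 0 < eps / 6 by lra.
have near_y : \forall t \near y, mdist (f (x, y)) (f (x, t)) < eps / 6.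
  apply: metricType_numDomainType.cvgr_dist_lt => //; exact: hfx.
have [y' [Fy' /= fy']] := interior_subset Iy _ near_y.
have [H [oH H0 HG fH]] := hfy y' _ x G e6 (open_nbhs_nbhs (conj oG Gx)).
exists y', H; split=> //; split=> // x' Hx' _.
have /= := fH x' Hx'.
have := metric_triangle a (f (x', y')) (f (x, y')).
have := metric_triangle a (f (x, y')) (f (x, y)).
rewrite (metric_sym (f (x, y')) (f (x, y))).
rewrite (metric_sym (f (x', y')) (f (x, y'))).
lra.
Qed.

Theorem theorem3p7 (R : realType) (X Y : topologicalType) (Z : metricType R)
    (f : X * Y -> Z) (hX : baire_space X)
    (hY : exists D : set Y, dense D /\
       forall y, D y -> I_has_winning_strategy (@somewhere_dense Y) y)
    (hfx : forall x : X, continuous (fun y : Y => f (x, y)))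
    (hfy : forall y : Y, quasicontinuous (fun x : X => f (x, y))) :
  quasicontinuous f.
Proof.
move=> eps [x0 y0] N e0 [[N1 N2] /= [N1x N2y] N12].
set a := f (x0, y0).
have e6 : 0 < eps / 6 by lra.
have e3 : 0 < eps / 3 by lra.
have near_y0 : \forall t \near y0, mdist a (f (x0, t)) < eps / 6.
  apply: metricType_numDomainType.cvgr_dist_lt => //; exact: hfx.
pose V := interior (N2 `&` [set y | mdist a (f (x0, y)) < eps / 6]).
have oV : open V by exact: open_interior.
have Vy0 : V y0 by apply: filterI.
have VN y : V y -> N2 y /\ mdist a (f (x0, y)) < eps / 6.
  by move=> /interior_subset.
have [D [Dd hD]] := hY.
have [y1 [Vy1 Dy1]] := Dd V (ex_intro _ _ Vy0) oV.
have [tau [tauL tauW]] := hD _ Dy1.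
have [U [oU U0 UN fU]] := hfy y1 _ x0 _ e6 N1x.
have close_y1 x : U x -> mdist a (f (x, y1)) < eps / 3.
  move=> Ux; have /= := fU x Ux; have [_] := VN _ Vy1.
  by have := metric_triangle a (f (x0, y1)) (f (x, y1)); lra.
apply: contrapT => nqc.
have far G W : open G -> G !=set0 -> G `<=` U ->
    open W -> W !=set0 -> W `<=` V ->
    exists x y, [/\ G x, W y & eps <= mdist a (f (x, y))].
  move=> oG [x Gx] GU oW [y Wy] WV.
  apply: contrapT => nofar; apply: nqc; exists (G `*` W); split.
  - rewrite openE => -[u v] [/= Gu Wv].
    by exists (G, W) => //; split; exact: open_nbhs_nbhs.
  - by exists (x, y).
  - by move=> [u v] [/= Gu Wv]; apply: N12; split=> /=;
      [exact/UN/GU|case: (VN v (WV v Wv))].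
  - move=> [u v] [/= Gu Wv]; rewrite ltNge; apply/negP => fuv.
    by apply: nofar; exists u, v.
pose P s y := [set x | tau s y /\
  (V y -> 2 / 3 * eps <= mdist a (f (x, y)))].
have [|x [y_ [Ux play]]] := @baire_play X Y U P hX oU U0.
  move=> s G oG G0 GU.
  have [y [H [oH H0 HG [Fy Hfar]]]] :=
    far_reply f eps a U V hfx hfy e0 oV far _ G (tauL s) oG G0 GU.
  by exists y, H; split=> // x Hx; split=> //; exact: Hfar.
have cl : closure (range y_) y1 by apply: tauW => n; case: (play n).
have near_y1 : \forall t \near y1, mdist (f (x, y1)) (f (x, t)) < eps / 3.
  apply: metricType_numDomainType.cvgr_dist_lt => //; exact: hfx.
have [_ [[n _ <-] [/= fn Vn]]] :=
  cl _ (filterI near_y1 (open_nbhs_nbhs (conj oV Vy1))).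
have [_ /(_ Vn)] := play n.
have := close_y1 x Ux.
have := metric_triangle a (f (x, y1)) (f (x, y_ n)).
lra.
Qed.
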